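(* Let $n>2$, let $p$ be the period of $f(x)=a^x \bmod n$, where $0<a<n$ and $\gcd(a,n)=1$, and let $N$ be a power of $2$ with $n^2<N<2n^2$. For every $j\in\mathbb{N}$ let $t_j\in\mathbb{N}$ be a number with $(t_j-1)p\le jN\le t_jp$. Then for every $k\in\{0,\dots,p-1\}$ we have $$t_{k+1}>t_k+1,$$ and, for $k\ge 1$, also $$t_{k-1}<t_k-1 .$$
   Context: Here $\mathbb{N}$ includes $0$. The function $f:\mathbb{N}\to\mathbb{N}$, $f(x)=a^x\bmod n$, is modular exponentiation, where $z\bmod n$ is the remainder of $z$ on division by $n$. Its period $p$ is the smallest positive integer with $f(x)=f(x+p)$ for all $x\in\mathbb{N}$. The inequalities involving $t_j$ are to be shown for any choice of numbers $t_j$ satisfying the stated condition (such $t_j$ exist). *)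

(* Defs.v *)
From mathcomp Require Import all_boot all_order all_algebra.
Set Implicit Arguments.
Unset Strict Implicit.
Unset Printing Implicit Defensive.

Definition modexp (a n x : nat) : nat := a ^ x %% n.

Definition periodic_with (f : nat -> nat) (q : nat) : Prop :=
  0 < q /\ forall x : nat, f x = f (x + q).

Definition is_period (f : nat -> nat) (p : nat) : Prop :=
  periodic_with f p /\ forall q : nat, periodic_with f q -> p <= q.

(* Main.v *)
Require Import Defs.
From mathcomp Require Import all_boot all_order all_algebra.
From mathcomp Require Import cyclic zify.
Set Implicit Arguments.
Unset Strict Implicit.
Unset Printing Implicit Defensive.

(** The number [j N] lies in [[(t_j - 1) p, t_j p]], the [t_j]-th interval of
    length [p].  From [(t_j - 1) p <= j N] and [(j + 1) N <= t_(j+1) p] one gets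
    [N <= (t_(j+1) - t_j + 1) p], so [2 p < N] forces [t_(j+1) - t_j > 1]: this
    is [index_gap].  The period is indeed that small compared with [N]: Euler's
    theorem gives [p <= n] ([period_modexp_leq]), while [2 n <= n ^ 2 < N].  Both
    inequalities are instances of [index_gap], at [j = k] and [j = k - 1]. *)

Lemma totient_leq n : totient n <= n.
Proof.
rewrite totient_count_coprime -[leqRHS]muln1 -[X in _ <= X * _]subn0.
by rewrite -sum_nat_const_nat; apply: leq_sum => i _; apply: leq_b1.
Qed.

Lemma totient_periodic a n :
  0 < n -> coprime a n -> periodic_with (modexp a n) (totient n).
Proof.
move=> n_gt0 co_an; split=> [|x]; first by rewrite totient_gt0.
by rewrite /modexp expnD -modnMmr Euler_exp_totient // modnMmr muln1.
Qed.

Lemma period_modexp_leq a n p :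
  0 < n -> coprime a n -> is_period (modexp a n) p -> p <= n.
Proof.
move=> n_gt0 co_an [_ p_min].
exact: leq_trans (p_min _ (totient_periodic n_gt0 co_an)) (totient_leq n).
Qed.

(** If the indices of two consecutive multiples of [N] differed by at most 1,
    two intervals of length [p] would cover a step of length [N]. *)
Lemma index_gap (p N : nat) (t : nat -> nat) (j : nat) :
    2 * p < N ->
    (forall i : nat,
      (((t i)%:Z - 1) * p%:Z <= (i * N)%N%:Z <= (t i * p)%N%:Z)%R) ->
  t j + 1 < t j.+1.
Proof.
move=> lt2pN ht; have /andP[lo_j _] := ht j; have /andP[_ hi_j1] := ht j.+1.
rewrite ltnNge; apply/negP => le_t.
have le_tp : t j.+1 * p <= (t j + 1) * p by rewrite leq_mul2r le_t orbT.
nia.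
Qed.

(* The subtractions t_j - 1 are taken in int, so they are not truncated. *)
Theorem mainTheorem3 (n a p N : nat) (t : nat -> nat)
    (hn : 2 < n)
    (ha : 0 < a < n)
    (han : gcdn a n = 1)
    (hp : is_period (modexp a n) p)
    (hNpow : exists m : nat, N = 2 ^ m)
    (hN : n ^ 2 < N < 2 * n ^ 2)
    (ht : forall j : nat,
        (((t j)%:Z - 1) * p%:Z <= (j * N)%N%:Z <= (t j * p)%N%:Z)%R) :
  forall k : nat, k < p ->
    (t k.+1 > t k + 1) /\
    (1 <= k -> ((t k.-1)%:Z < (t k)%:Z - 1)%R).
Proof.
have n_gt0 : 0 < n by apply: ltn_trans hn.
have co_an : coprime a n by rewrite /coprime han.
have le_pn := period_modexp_leq n_gt0 co_an hp.
have lt2pN : 2 * p < N.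
  have /andP[lt_n2N _] := hN; apply: leq_ltn_trans lt_n2N.
  by rewrite expnS expn1 leq_mul // ltnW.
move=> k _; split=> [|k_gt0]; first exact: index_gap lt2pN ht.
have := index_gap k.-1 lt2pN ht; rewrite prednK //; lia.
Qed.
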